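(* Let $X_n$, $n\in\omega$, be first countable Hausdorff spaces and let $\nabla=\nabla_n X_n$ be their nabla product. (1) Every subspace of $\nabla$ of size no more than $\mathfrak{d}$ is hereditarily $D$. (2) Hence, if $\mathfrak{d}=\mathfrak{c}$ and each $X_n$ has size no more than $\mathfrak{c}$, then $\nabla$ is hereditarily $D$. (3) So, if $\mathfrak{d}=\mathfrak{c}$, then the box product $\square_n K_n$ of any sequence $(K_n)_{n\in\omega}$ of compact, first countable Hausdorff spaces is a $D$-space.
   Context: $\mathfrak{c}=2^{\aleph_0}$, and $\mathfrak{d}$ is the minimal size of a cofinal family in $\omega^\omega$ with the coordinatewise order. A neighbornet on a space $(X,\tau)$ is a map $U:X\to\tau$ with $x\in U(x)$ for all $x\in X$. $X$ is a $D$-space if for every neighbornet $U$ on $X$ there is a closed discrete $D\subseteq X$ with $\bigcup_{x\in D}U(x)=X$. A space is hereditarily $D$ if each of its subspaces is a $D$-space. $\square_n X_n$ is the set $\prod_n X_n$ with the topology generated by all sets $\prod_n U_n$ with every $U_n$ open in $X_n$. $\nabla_n X_n$ is the quotient space $(\square_n X_n)/{=^*}$, where $x=^*y$ iff $x(n)=y(n)$ for all but finitely many $n$. *)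

(* Defs.v *)
From HB Require Import structures.
From mathcomp Require Import all_boot all_order all_algebra.
From mathcomp Require Import all_classical all_reals topology.

Set Implicit Arguments.
Unset Strict Implicit.
Unset Printing Implicit Defensive.

Local Open Scope classical_set_scope.
Local Open Scope card_scope.

(* Cardinals are represented by sets having that size, and compared with the
   library's [#<=] and [#=]. *)

Lemma card_le_minimum (T : pointedType) (P : set (set T)) : P !=set0 ->
  exists2 A, P A & forall B, P B -> A #<= B.
Proof.
move=> [A0 PA0].
(* a maximal set of pairwise everywhere-distinct choice functions on P *)
pose Q (G : set (set T -> T)) :=
  (forall g A, G g -> P A -> A (g A)) /\
  (forall g h A, G g -> G h -> P A -> g A = h A -> g = h).
have [G [[Gch Ginj] Gmax]] : exists G, Q G /\ forall H, G `<` H -> ~ Q H.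
  apply: Zorn_bigcup => F FQ Ftot; split.
    by move=> g A [H FH Hg] PA; have [ch _] := FQ _ FH; exact: (ch _ _ Hg PA).
  move=> g h A [H FH Hg] [K FK Kh] PA.
  have [sHK|sKH] := Ftot _ _ FH FK.
    by have [_ inj] := FQ _ FK; apply: (inj _ _ A) => //; exact: sHK.
  by have [_ inj] := FQ _ FH; apply: (inj _ _ A) => //; exact: sKH.
have [A PA AG] : exists2 A, P A & A `<=` (fun g : set T -> T => g A) @` G.
  apply: contrapT => noA.
  have /choice[g gP] (A : set T) : exists a, P A ->
      A a /\ ~ ((fun g : set T -> T => g A) @` G) a.
    have [PA|nPA] := pselect (P A); last by exists point.
    have [a aP] : exists a, ~ (A a -> ((fun g : set T -> T => g A) @` G) a).
      by apply/existsNP => AG; apply: noA; exists A.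
    by exists a => _; apply/not_implyP.
  apply: (Gmax (G `|` [set g])).
    split; first by move=> h Gh; left.
    move=> /(_ g (or_intror erefl)) Gg.
    by have [_] := gP _ PA0; apply; exists g.
  split=> [h A [Gh|->] PA|h k A [Gh|->] [Gk|->] PA hk //].
  - exact: (Gch _ _ Gh PA).
  - by have [] := gP _ PA.
  - exact: (Ginj _ _ A).
  - by have [_] := gP _ PA; case; exists h.
  - by have [_] := gP _ PA; case; exists k.
exists A => // B PB.
apply: (@card_le_trans _ _ _ G).
  apply: card_le_trans (card_image_le (fun g : set T -> T => g A) G).
  exact: subset_card_le.
apply/pcard_leP/injfunPex; exists (fun g : set T -> T => g B) => [g Gg|g h].
  exact: (Gch _ _ Gg PB).
by move=> /set_mem Gg /set_mem Gh; exact: (Ginj _ _ B).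
Qed.

Definition cofinal (F : set (nat -> nat)) :=
  forall f : nat -> nat, exists2 g, F g & forall n, (f n <= g n)%N.

Definition min_cofinal (F : set (nat -> nat)) :=
  cofinal F /\ forall F', cofinal F' -> F #<= F'.

Lemma min_cofinal_exists : exists F, min_cofinal F.
Proof.
have [|F cF Fmin] := @card_le_minimum (nat -> nat) cofinal; last by exists F.
by exists setT => f; exists f.
Qed.

Definition dominating_number : set (nat -> nat) := get min_cofinal.

Lemma dominating_numberP : min_cofinal dominating_number.
Proof. exact: (getPex min_cofinal_exists). Qed.

Notation continuum := [set: nat -> bool].

Definition first_countable (T : topologicalType) :=
  forall x : T, exists B : set (set T),
    [/\ countable B, B `<=` nbhs x &
        forall V, nbhs x V -> exists2 W, B W & W `<=` V].

Definition neighbornet (T : topologicalType) (U : T -> set T) :=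
  forall x, open (U x) /\ U x x.

Definition discrete_subset (T : topologicalType) (D : set T) :=
  forall x, D x -> isolated D x.

Definition D_space (T : topologicalType) :=
  forall U : T -> set T, neighbornet U ->
    exists D : set T,
      [/\ closed D, discrete_subset D & \bigcup_(x in D) U x = [set: T]].

(* [set_type A] carries the topology induced by the inclusion, unlike the
   library's [subspace A], whose carrier is all of [T]. *)
Definition hereditarily_D (T : topologicalType) :=
  forall A : set T, D_space (set_type A).

Definition box_product (X : nat -> Type) : Type := forall n, X n.

Section BoxProduct.
Variable X : nat -> topologicalType.

HB.instance Definition _ := Choice.on (box_product X).

Definition box (U : forall n, set (X n)) : set (box_product X) :=
  [set x | forall n, U n (x n)].

Definition open_boxes : set (forall n, set (X n)) :=
  [set U | forall n, open (U n)].

Lemma box_cover : \bigcup_(U in open_boxes) box U = setT.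
Proof.
by apply/seteqP; split=> // x _; exists (fun=> setT) => // n; exact: openT.
Qed.

Lemma box_join (U V : forall n, set (X n)) (x : box_product X) :
  open_boxes U -> open_boxes V -> box U x -> box V x ->
  exists W, [/\ open_boxes W, box W x & box W `<=` box U `&` box V].
Proof.
move=> oU oV Ux Vx; exists (fun n => U n `&` V n); split.
- by move=> n; exact: openI.
- by move=> n; split.
- by move=> y UVy; split=> n; have [] := UVy n.
Qed.

HB.instance Definition _ :=
  @isBaseTopological.Build (box_product X) (forall n, set (X n))
    open_boxes box box_cover box_join.

End BoxProduct.

Section NablaProduct.
Variable X : nat -> topologicalType.

Definition eqstar (x y : box_product X) : bool :=
  `[< finite_set [set n | x n <> y n] >].

Lemma eqstar_refl : reflexive eqstar.
Proof.
move=> x; apply/asboolP.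
by apply: sub_finite_set (finite_set0 nat) => n /(_ erefl).
Qed.

Lemma eqstar_sym : symmetric eqstar.
Proof.
move=> x y; apply/asboolP/asboolP; apply: sub_finite_set => n /= ne /esym;
  exact: ne.
Qed.

Lemma eqstar_trans : transitive eqstar.
Proof.
move=> y x z /asboolP xy /asboolP yz; apply/asboolP.
have : finite_set ([set n | x n <> y n] `|` [set n | y n <> z n]).
  by rewrite finite_setU.
apply: sub_finite_set => n /= xz.
have [xyn|] := pselect (x n = y n); last by left.
by right; rewrite -xyn.
Qed.

Definition eqstar_equiv : equiv_rel (box_product X) :=
  EquivRel eqstar eqstar_refl eqstar_sym eqstar_trans.

Definition nabla_product : Type :=
  quotient_topology {eq_quot eqstar_equiv}%qT.

End NablaProduct.

(* Main.v *)
Require Import Defs.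
From HB Require Import structures.
From mathcomp Require Import all_boot all_order all_algebra.
From mathcomp Require Import all_classical all_reals topology.
From mathcomp Require Import wochoice.

Local Open Scope classical_set_scope.
Local Open Scope card_scope.

Set Implicit Arguments.
Unset Strict Implicit.
Unset Printing Implicit Defensive.

(** Call a set small when it has fewer than [dominating_number] elements.

    In a nabla product of first countable T1 spaces every small set is closed
    and discrete.  Fix a class [w], represented by the sequence [x], and choose
    decreasing countable bases at the points [x n].  The basic neighborhoods of
    [w] are then indexed by functions [f : nat -> nat].  A class [v] other than
    [w] is represented by a sequence that differs from [x] on an infinite set
    [I]; to keep [v] out of a basic neighborhood it is enough that [f] exceeds,
    infinitely often along [I], a function read off from [v].  A single monotone
    [f] does this for all members of a small set, because fewer than
    [dominating_number] functions do not dominate every function, even up to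
    finitely many arguments ([exists_undominated],
    [nabla_small_closed_discrete]).

    A space of size at most [dominating_number] in which small sets are closed
    and discrete is a D-space: enumerate it along a well-order with small
    initial segments and keep a point whenever no point kept before covers it.
    The neighborhood assigned to a kept point contains only kept points that
    come before or coincide with it, hence a closed discrete set of them
    ([small_closed_discrete_D_space]).  Both hypotheses pass to subspaces, which
    gives (1); for (2), a product of countably many sets of size at most the
    continuum has size at most the continuum.

    For (3), a compact first countable Hausdorff space has size at most the
    continuum ([card_compact_first_countable], the countable character case of
    Arhangel'skii's theorem), so the nabla product of the factors is a D-space.
    The D-property lifts to the box product ([box_product_D_space]) because the
    quotient map is closed ([nabla_class_tube]) with sigma-compact fibres: each
    fibre is covered by a set that is closed and discrete in it
    ([fibre_closed_discrete_cover]), closedness of the map makes such a cover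
    valid over a neighborhood of the class, and a closed discrete set of
    classes selects the fibres to use. *)

(** * Cardinals below the dominating number *)

Lemma injection_of_card_le (T U : Type) (A : set T) (B : set U) (u : U) :
  A #<= B -> exists2 f : T -> U, forall x, A x -> B (f x) &
    forall x y, A x -> A y -> f x = f y -> x = y.
Proof.
move=> /card_leP[g].
have /choice[f fP] (x : T) : exists v, forall Ax : A x,
    v = set_val (g (exist _ x (mem_set Ax))).
  have [Ax|nAx] := pselect (A x); last by exists u => Ax; case: nAx.
  exists (set_val (g (exist _ x (mem_set Ax)))) => Ax'.
  by rewrite (Prop_irrelevance Ax Ax').
exists f => [x Ax|x y Ax Ay]; first by rewrite (fP _ Ax); exact: set_valP.
rewrite (fP _ Ax) (fP _ Ay) => /val_inj /inj.
by rewrite !inE => /(_ I I) [].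
Qed.

Lemma card_le_of_injection (T U : Type) (A : set T) (B : set U) (f : T -> U) :
  (forall x, A x -> B (f x)) ->
  (forall x y, A x -> A y -> f x = f y -> x = y) -> A #<= B.
Proof.
move=> fAB finj.
have /injfunPex[g] : exists2 f : T -> U, set_fun A B f & set_inj A f.
  by exists f => // x y /set_mem Ax /set_mem Ay; exact: finj.
exact: inj_card_le g.
Qed.

Lemma countable_enum (T : Type) (A : set T) (t : T) :
  countable A -> exists e : nat -> T, A `<=` range e.
Proof.
move=> /countable_injP[f finj].
have /choice[e eP] (n : nat) : exists u, forall s, A s -> f s = n -> s = u.
  have [[s [As fs]]|nos] := pselect (exists s, A s /\ f s = n).
    by exists s => s' As' fs'; apply: finj; rewrite ?inE ?fs ?fs'.
  by exists t => s As fs; case: nos; exists s.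
by exists e => s As; exists (f s) => //; rewrite -(eP _ _ As).
Qed.

(** By Zorn's lemma, take a maximal family [G] of injective sequences in [S]
    with disjoint ranges; by maximality only finitely many points of [S] are
    left over.  Each range is in bijection with [nat], hence with
    [bool * nat * nat]: one copy of [nat * nat] lists the pairs whose first
    component lies on that range, and the other copy lists the pairs whose
    first component is a leftover point. *)
Lemma infinite_card_prod_nat (T : Type) (S : set T) :
  infinite_set S -> S `*` [set: nat] #<= S.
Proof.
move=> Sinf.
have [s0 Ss0] := infinite_setN0 Sinf.
pose Q (G : set (nat -> T)) :=
  (forall h, G h -> injective h /\ forall i, S (h i)) /\
  (forall h k i j, G h -> G k -> h i = k j -> h = k).
have [G [[GS Gdisj] Gmax]] : exists G, Q G /\ forall H, G `<` H -> ~ Q H.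
  apply: Zorn_bigcup => F FQ Ftot; split.
    by move=> h [H FH Hh]; have [+ _] := FQ _ FH; apply.
  move=> h k i j [H FH Hh] [K FK Kk].
  have [sHK|sKH] := Ftot _ _ FH FK.
    by have [_] := FQ _ FK; apply => //; exact: sHK.
  by have [_] := FQ _ FH; apply => //; exact: sKH.
pose R := [set s | exists h i, G h /\ s = h i].
have Pfin : finite_set (S `\` R).
  apply: contrapT => /infiniteP/(injection_of_card_le s0)[h hP hinj'].
  have hinj : injective h by move=> i j; exact: hinj'.
  apply: (Gmax (G `|` [set h])).
    split; first by left.
    move=> /(_ h (or_intror erefl)) Gh.
    by have [_] := hP 0%N I; apply; exists h, 0%N.
  split=> [k [Gk|->]|k l i j [Gk|->] [Gl|->] //].
  - exact: GS.
  - by split=> // i; have [] := hP i I.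
  - exact: Gdisj.
  - move=> kh; have [_] := hP j I.
    by case; exists k, i; rewrite kh.
  - move=> hl; have [_] := hP i I.
    by case; exists l, j; rewrite hl.
have [h0 Gh0] : exists h0, G h0.
  apply: contrapT => G0; apply: Sinf; apply: sub_finite_set Pfin => s Ss.
  by split=> // -[h [i [Gh _]]]; apply: G0; exists h.
have [p pP] := countable_enum s0 (finite_set_countable Pfin).
(* [p] enumerates the leftover points *)
pose dec (h : nat -> T) (i : nat) :=
  if unpickle i is Some (e, a, b) then (if e : bool then h a else p a, b : nat)
  else (s0, 0%N).
have /choice[f fP] (s : T) :
    exists w, forall h i, G h -> s = h i -> w = dec h i.
  have [[h [i [Gh ->]]]|nR] := pselect (R s).
    exists (dec h i) => k j Gk hk; have hk' := Gdisj _ _ _ _ Gh Gk hk.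
    by subst k; have [hinj _] := GS _ Gh; rewrite (hinj _ _ hk).
  by exists (s0, 0%N) => h i Gh si; case: nR; exists h, i.
apply: (@card_le_trans _ _ _ (f @` R)); last first.
  apply: card_le_trans (card_image_le f R) _; apply: subset_card_le.
  by move=> s [h [i [Gh ->]]]; have [_] := GS _ Gh.
apply: subset_card_le => -[s b] [/= Ss _].
have [[h [i [Gh ->]]]|nR] := pselect (R s).
  exists (h (pickle (true, i, b))); first by exists h, (pickle (true, i, b)).
  by rewrite (fP _ _ _ Gh erefl) /dec pickleK.
have [a _ <-] := pP s (conj Ss nR).
exists (h0 (pickle (false, a, b))); first by exists h0, (pickle (false, a, b)).
by rewrite (fP _ _ _ Gh0 erefl) /dec pickleK.
Qed.

(** Diagonalization: [n |-> (e n n).+1] is not below any [e n]. *)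
Lemma countable_not_cofinal (G : set (nat -> nat)) : countable G -> ~ cofinal G.
Proof.
move=> /(countable_enum (fun=> 0%N))[e eG] Gcof.
have [g Gg gP] := Gcof (fun n => (e n n).+1).
have [n _ en] := eG _ Gg.
by have := gP n; rewrite -en ltnn.
Qed.

Lemma dominating_number_infinite : infinite_set dominating_number.
Proof.
move=> /finite_set_countable dc; apply: countable_not_cofinal dc _.
by have [] := dominating_numberP.
Qed.

(** The family indexed by [S] need not be closed under finite modifications, so
    [S] is first replaced by [S * nat]: if no function [maxn (g s n) k]
    dominates [f], then [f] beats [g s] at arguments where [f] itself is
    arbitrarily large, and these arguments are unbounded. *)
Lemma exists_undominated (T : Type) (S : set T) (g : T -> nat -> nat) :
  ~ (dominating_number #<= S) ->
  exists2 f : nat -> nat, {homo f : m n / (m <= n)%N} &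
    forall s, S s -> forall k, exists2 n, (k <= n)%N & (g s n < f n)%N.
Proof.
move=> Ssmall.
pose b (w : T * nat) n := maxn (g w.1 n) w.2.
have : ~ cofinal (b @` (S `*` [set: nat])).
  have [dcof dmin] := dominating_numberP; move=> bcof.
  have [Sfin|Sinf] := pselect (finite_set S).
    apply: countable_not_cofinal bcof.
    apply: sub_countable (card_image_le _ _) _.
    by apply: countableX => //; exact: finite_set_countable.
  apply: Ssmall; apply: card_le_trans (dmin _ bcof) _.
  apply: card_le_trans (card_image_le _ _) _.
  exact: infinite_card_prod_nat.
move=> /existsNP[f0 f0P]; pose f n := \max_(i < n.+1) f0 i.
have f0f n : (f0 n <= f n)%N by exact: (leq_bigmax (ord_max : 'I_n.+1)).
have fhomo : {homo f : m n / (m <= n)%N}.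
  move=> m n mn; apply/bigmax_leqP => i _.
  have im : (i < n.+1)%N by apply: leq_trans (ltn_ord i) _.
  exact: (leq_bigmax (Ordinal im)).
exists f => // s Ss k.
(* the bound [f k] forces the witness [n] past [k], since [f] is monotone *)
have [n fn] : exists n, (b (s, f k) n < f0 n)%N.
  apply: contrapT => nof; apply: f0P; exists (b (s, f k)).
    by exists (s, f k).
  by move=> n; rewrite leqNgt; apply/negP => fn; apply: nof; exists n.
move: fn; rewrite /b /= gtn_max => /andP[gf kf]; exists n.
  apply: contraT; rewrite -ltnNge => /ltnW/fhomo fnk.
  by have := leq_trans kf (leq_trans (f0f n) fnk); rewrite ltnn.
exact: leq_trans gf (f0f n).
Qed.

(** If some initial segment of a well-order on [T] is too large, the least one
    that is too large has small initial segments and [T] embeds into it, since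
    [T] is at most the size of [F]; the order of the segment is pulled back. *)
Lemma wellorder_small_segments (T U : Type) (F : set U) :
  [set: T] #<= F ->
  exists R : T -> T -> Prop,
    [/\ well_founded R, forall x y, x <> y -> R x y \/ R y x &
        forall x, ~ (F #<= [set y | R y x])].
Proof.
move=> TF.
have [L Lwo] := @well_ordering_principle {classic T}.
pose lt (x y : T) := ~ L y x.
have min (P : T -> Prop) : (exists x, P x) ->
    exists2 x, P x & forall y, P y -> ~ lt y x.
  move=> [x Px]; have [|m [[/asboolP Pm lbm] _]] := Lwo (fun x => `[< P x >]).
    by exists x; apply/asboolP.
  by exists m => // y Py; apply; apply: lbm; apply/asboolP.
have lt_wf : well_founded lt.
  move=> x; apply: contrapT => nx.
  have [|y ny ymin] := min (fun x => ~ Acc lt x); first by exists x.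
  apply: ny; constructor => z zy; apply: contrapT => nz; exact: (ymin z).
have anti x y : L x y -> L y x -> x = y.
  move=> Lxy Lyx.
  have T2 : {in <= predT, well_order L} by move=> A _; exact: Lwo.
  have := @wo_chain_antisymmetric {classic T} L predT T2 x y.
  by apply => //; rewrite Lxy.
have lt_total x y : x <> y -> lt x y \/ lt y x.
  move=> xy; apply: contrapT => /not_orP[/contrapT Lyx /contrapT Lxy].
  by apply: xy; exact: anti.
have [[x0 Fx0]|nF] := pselect (exists x, F #<= [set y | lt y x]); last first.
  by exists lt; split=> // x Fx; apply: nF; exists x.
have [|x Fx xmin] := min (fun x => F #<= [set y | lt y x]); first by exists x0.
have [j jx jinj] := injection_of_card_le x (card_le_trans TF Fx).
exists (fun y z => lt (j y) (j z)); split.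
- suff wf a y : a = j y -> Acc (fun y z => lt (j y) (j z)) y.
    by move=> y; exact: wf.
  move: a y; apply: (well_founded_ind lt_wf) => a IH y ay; constructor => z zy.
  by apply: (IH (j z)) => //; rewrite ay.
- by move=> y z yz; apply: lt_total => jyz; apply: yz; exact: jinj.
- move=> z Fz; apply: (xmin (j z)); last exact: jx.
  apply: card_le_trans Fz _.
  apply: (card_le_of_injection (f := j)) => // y y' _ _.
  exact: jinj.
Qed.

(** * D-spaces from small closed discrete sets *)

Lemma closed_discreteP (T : topologicalType) (D : set T) :
  (forall x, \forall y \near x, D y -> y = x) <->
  closed D /\ discrete_subset D.
Proof.
split=> [Dx|[Dcl Ddisc] x].
  split=> [x Dclx|x xD]; last first.
    split; first exact: mem_set.
    exists [set y | D y -> y = x]; first exact: Dx.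
    by apply/seteqP; split=> [y [/= + Dy]|y ->]; [apply|split].
  by have [y [Dy yx]] := Dclx _ (Dx x); rewrite -(yx Dy).
have [xD|nxD] := pselect (D x); last first.
  have : nbhs x (~` D).
    by apply: open_nbhs_nbhs; split=> //; exact: closed_openC.
  by apply: filterS => y nDy /nDy.
have [_ [V Vx VD]] := Ddisc _ xD.
by apply: filterS Vx => y Vy yD; have : (V `&` D) y by []; rewrite VD.
Qed.

(** The property is stated pointwise, with small meaning not at least as large
    as [F]; by [closed_discreteP] it says that small sets are closed and
    discrete. *)
Definition small_closed_discrete (U : Type) (F : set U) (T : topologicalType) :=
  forall (S : set T) (x : T), ~ (F #<= S) -> \forall y \near x, S y -> y = x.

Lemma small_closed_discrete_sub (U : Type) (F : set U) (T : topologicalType)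
    (A : set T) :
  small_closed_discrete F T -> small_closed_discrete F (set_type A).
Proof.
move=> FT S x FS.
have FS' : ~ (F #<= set_val @` S).
  by move=> /card_le_trans/(_ (card_image_le _ _)).
have : nbhs x (set_val @^-1` [set y | (set_val @` S) y -> y = set_val x]).
  exact: (@initial_continuous _ _ (@set_val T A) x _ (FT _ (set_val x) FS')).
by apply: filterS => y /= yx Sy; apply: val_inj; apply: yx; exists y.
Qed.

(** Along a well-order with small initial segments, keep the points that are not
    covered by the points kept before them.  A kept point [z] in the
    neighborhood of a kept point [y] satisfies [z = y] or comes before [y], and
    the initial segment below [y] is closed and discrete. *)
Lemma small_closed_discrete_D_space (U : Type) (F : set U)
    (T : topologicalType) :
  infinite_set F -> small_closed_discrete F T -> [set: T] #<= F -> D_space T.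
Proof.
move=> Finf FT TF N NN.
have [R [Rwf Rtot Rsmall]] := wellorder_small_segments TF.
have [D DE] : exists D : set T,
    forall x, D x <-> forall y, R y x -> D y -> ~ N y x.
  (* greedy choice, by well-founded recursion *)
  pose step x (rec : forall y, R y x -> Prop) :=
    forall y (yx : R y x), rec y yx -> ~ N y x.
  exists (Fix Rwf (fun=> Prop) step) => x.
  rewrite Fix_eq // => z f g fg.
  by congr step; apply: functional_extensionality_dep => y; apply: funext.
have cover x : exists2 y, D y & N y x.
  have [Dx|nDx] := pselect (D x); first by exists x => //; have [] := NN x.
  apply: contrapT => nox; apply: nDx; apply/DE => y _ Dy Nyx.
  by apply: nox; exists y.
exists D.
have /closed_discreteP[Dcl Dd] : forall x, \forall y \near x, D y -> y = x.
  move=> x; have [y Dy Nyx] := cover x.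
  have yfin : ~ (F #<= [set y]).
    by move=> /card_le_finite/(_ (finite_set1 y)).
  have Nx : nbhs x (N y) by apply: open_nbhs_nbhs; split=> //; have [] := NN y.
  have yx := FT _ x yfin; have sx := FT _ x (Rsmall y).
  near=> z => Dz.
  have [zy|/Rtot[zy|yz]] := pselect (z = y).
  - by apply: (near yx z).
  - by apply: (near sx z).
  - by have /DE/(_ y yz Dy) := Dz; case; near: z.
  split=> //; apply/seteqP; split=> // x _.
by have [y Dy Nyx] := cover x; exists y.
Unshelve. all: by end_near. Qed.

Lemma small_closed_discrete_hereditarily_D (U : Type) (F : set U)
    (T : topologicalType) :
  infinite_set F -> small_closed_discrete F T -> [set: T] #<= F ->
  hereditarily_D T.
Proof.
move=> Finf FT TF A; apply: small_closed_discrete_D_space Finf _ _.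
  exact: small_closed_discrete_sub.
apply: card_le_trans TF.
apply: (card_le_of_injection (f := set_val)) => // x y _ _.
exact: val_inj.
Qed.

(** * Small sets in a nabla product *)

Lemma open_decreasing_base (T : topologicalType) : first_countable T ->
  exists b : T -> nat -> set T, forall x,
    [/\ forall n, open (b x n), forall n, b x n x,
        forall m n, (m <= n)%N -> b x n `<=` b x m &
        forall V, nbhs x V -> exists n, b x n `<=` V].
Proof.
move=> Tfc.
suff H : forall x, exists b : nat -> set T,
    [/\ forall n, open (b n), forall n, b n x,
        forall m n, (m <= n)%N -> b n `<=` b m &
        forall V, nbhs x V -> exists n, b n `<=` V].
  by have /choice[b bP] := H; exists b.
move=> x; have [B [Bct Bnbhs Bbase]] := Tfc x.
have [W BW _] := Bbase _ filterT.
have [e eB] := countable_enum W Bct.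
pose b n := [set y | forall i : 'I_n.+1, nbhs x (e i) -> e i y].
exists (fun n => (b n)°); split=> [n|n|m n mn|V xV].
- exact: open_interior.
- have : nbhs x (b n); last by [].
  apply: filter_forall => i.
  have [xi|nxi] := pselect (nbhs x (e i)); first by apply: filterS xi.
  by apply: filterS filterT => y _ /nxi.
- apply: interiorS => y bny i.
  have im : (i < n.+1)%N by apply: leq_trans (ltn_ord i) _.
  exact: (bny (Ordinal im)).
- have [W' /[dup] BW' /eB[n _ enW'] W'V] := Bbase _ xV.
  exists n => y /interior_subset/(_ ord_max) /=; rewrite enW' => bny.
  by apply/W'V/bny/Bnbhs.
Qed.

Lemma open_box (X : nat -> topologicalType) (U : forall n, set (X n)) :
  (forall n, open (U n)) -> open (box U).
Proof. by move=> Uo; exists [set U] => [_ ->//|]; rewrite bigcup_set1. Qed.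

Lemma nbhs_boxP (X : nat -> topologicalType) (x : box_product X)
    (W : set (box_product X)) :
  nbhs x W <->
  exists U : forall n, set (X n),
    [/\ forall n, open (U n), box U x & box U `<=` W].
Proof.
split; last first.
  move=> [U [Uo Ux UW]]; apply: filterS UW _; apply: open_nbhs_nbhs.
  by split=> //; exact: open_box.
rewrite nbhsE => -[_ [[D' D'o <-] [U D'U Ux] D'W]].
by exists U; split=> // [|y Uy]; [exact: D'o|apply: D'W; exists U].
Qed.

Section Nabla.
Variable X : nat -> topologicalType.
Implicit Types (x y : box_product X) (w : nabla_product X).

Definition nabla_class x : nabla_product X := (\pi_(nabla_product X) x)%qT.

Lemma nabla_class_repr w : nabla_class (repr w) = w.
Proof. exact: reprK. Qed.

Lemma nabla_classP x y :
  nabla_class x = nabla_class y <-> \forall n \near \oo, x n = y n.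
Proof.
have -> : nabla_class x = nabla_class y <-> eqstar x y.
  split=> xy; first exact: (introT (@eqmodP _ (eqstar_equiv X) x y)).
  exact: (elimT (@eqmodP _ (eqstar_equiv X) x y)).
split=> [/asboolP|[N _ NP]]; last first.
  apply/asboolP; apply: sub_finite_set (finite_II N) => n /= xyn.
  by rewrite ltnNge; apply/negP => Nn; apply: xyn; exact: NP.
move=> /finite_seqP[s sP]; exists (\max_(i <- s) i).+1 => // n /= sn.
apply: contrapT => xyn; have : [set` s] n by rewrite -sP.
move=> /= ns; have := @leq_bigmax_seq _ s predT id n ns erefl.
by rewrite leqNgt sn.
Qed.

(** When no [U n] is empty, this is the image of [box U] under the quotient map.
    Replacing [repr w] by another representative changes finitely many
    coordinates, which a condition on almost all coordinates does not see. *)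
Definition eventually_in (U : forall n, set (X n)) : set (nabla_product X) :=
  [set w | \forall n \near \oo, U n (repr w n)].

Lemma eventually_inE (U : forall n, set (X n)) x :
  eventually_in U (nabla_class x) <-> \forall n \near \oo, U n (x n).
Proof.
have /nabla_classP xr : nabla_class (repr (nabla_class x)) = nabla_class x.
  exact: nabla_class_repr.
by split; apply: filterS2 xr => n ->.
Qed.

Lemma open_eventually_in (U : forall n, set (X n)) :
  (forall n, open (U n)) -> open (eventually_in U).
Proof.
move=> Uo.
suff : open (nabla_class @^-1` eventually_in U) by [].
rewrite openE => x /eventually_inE[N _ NU].
apply/nbhs_boxP.
exists (fun n => if (N <= n)%N then U n else setT); split.
- by move=> n; case: ifP => // _; exact: openT.
- by move=> n /=; case: ifP => // /NU.
move=> y yU; apply/eventually_inE; exists N => // n Nn.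
by have := yU n; rewrite Nn.
Qed.
End Nabla.

Arguments nabla_class {X} x.

(** For [v <> w], let [i v n >= n] be a place where representatives of [v] and
    [w] differ, and let [g v] say how far in the base at [w] one must go to exclude
    [v] at such a place.  A monotone [f] with [g v (i v n) < f n] for
    arbitrarily large [n] also satisfies [g v (i v n) < f (i v n)], so the
    basic neighborhood of [w] given by [f] omits [v]. *)
Lemma nabla_small_closed_discrete (X : nat -> topologicalType) :
  (forall n, first_countable (X n)) -> (forall n, accessible_space (X n)) ->
  small_closed_discrete dominating_number (nabla_product X).
Proof.
move=> Xfc XT1 S w Ssmall.
have /(_ _)/cid-/all_sig[b bP] n := open_decreasing_base (Xfc n).
have /choice[i iP] (v : nabla_product X) : exists i : nat -> nat, v <> w ->
    forall n, (n <= i n)%N /\ repr v (i n) <> repr w (i n).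
  have [vw|vw] := pselect (v = w); first by exists id.
  suff /choice[i iP] : forall n, exists m, (n <= m)%N /\ repr v m <> repr w m.
    by exists i.
  move=> n; apply: contrapT => nm; apply: vw.
  rewrite -(nabla_class_repr v) -(nabla_class_repr w); apply/nabla_classP.
  exists n => // m nm'; apply: contrapT => vwm; apply: nm; by exists m.
have /choice[g gP] (v : nabla_product X) : exists g : nat -> nat, forall n,
    repr v n <> repr w n -> ~ b n (repr w n) (g n) (repr v n).
  suff /choice[g gP] : forall n, exists m, repr v n <> repr w n ->
      ~ b n (repr w n) m (repr v n) by exists g.
  move=> n; have [vw|vw] := pselect (repr v n = repr w n); first by exists 0%N.
  have wv : nbhs (repr w n) (~` [set repr v n]).
    apply: open_nbhs_nbhs; split; last by move=> /esym.
    by rewrite openC; exact: accessible_closed_set1.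
  have [_ _ _ /(_ _ wv)[m mP]] := bP n (repr w n).
  by exists m => _ /mP; apply.
have [f fhomo fP] := exists_undominated (fun v n => g v (i v n)) Ssmall.
have : nbhs w (eventually_in (fun n => b n (repr w n) (f n))).
  apply: open_nbhs_nbhs; split.
    by apply: open_eventually_in => n; have [] := bP n (repr w n).
  by exists 0%N => // n _ /=; have [_ + _ _] := bP n (repr w n); apply.
apply: filterS => v [N _ Nv] Sv; apply: contrapT => vw.
have [n Nn gf] := fP v Sv N.
have [ni vwi] := iP v vw n.
apply: (gP v _ vwi).
have [_ _ bdec _] := bP (i v n) (repr w (i v n)).
apply: (bdec _ (f (i v n))); first exact: leq_trans (ltnW gf) (fhomo _ _ ni).
by apply: Nv => /=; exact: leq_trans Nn ni.
Qed.

(** * Sizes of products and of compact first countable spaces *)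

Lemma card_prod_continuum (X : nat -> Type) :
  (forall n, [set: X n] #<= continuum) -> [set: forall n, X n] #<= continuum.
Proof.
move=> Xc.
have H n : exists f : X n -> nat -> bool, injective f.
  have [f _ finj] := injection_of_card_le (fun=> false) (Xc n).
  by exists f => x y; exact: finj.
have /(_ _)/cid-/all_sig[f finj] := H.
apply: (card_le_of_injection (f := fun x k =>
  if unpickle k is Some (i, j) then f i (x i) j else false)) => // x y _ _ fxy.
apply: functional_extensionality_dep => i; apply: finj.
apply: funext => j; have := congr1 (@^~ (pickle (i, j))) fxy.
by rewrite /= pickleK.
Qed.

(** Terms over one constant and countably many operations of arity [nat]. *)
Inductive tree := leaf | node of nat & (nat -> tree).

(** The argument [p] is a path of successive children; the value [0] is kept for
    leaves and for paths that leave the tree, so that a tree is determined by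
    its labels. *)
Fixpoint label (t : tree) (p : seq nat) : nat :=
  match t, p with
  | leaf, _ => 0
  | node k _, [::] => k.+1
  | node _ f, i :: q => label (f i) q
  end.

Lemma label_inj : injective label.
Proof.
elim=> [|k f IH] [|l g] fg.
- by [].
- by have := congr1 (@^~ [::]) fg.
- by have := congr1 (@^~ [::]) fg.
have [->] := congr1 (@^~ [::]) fg; congr node; apply: funext => i.
by apply: IH; apply: funext => p; exact: (congr1 (@^~ (i :: p)) fg).
Qed.

Lemma card_tree : [set: tree] #<= continuum.
Proof.
apply: (card_le_of_injection (f := fun t k =>
  if unpickle k is Some (p, v) then label t p == v else false)) => //.
move=> s t _ _ st.
apply: label_inj; apply: funext => p.
have := congr1 (@^~ (pickle (p, label s p))) st.
by rewrite /= !pickleK eqxx => /esym/eqP.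
Qed.

(** A set closed under operations of infinite arity is usually built by a
    transfinite iteration of length omega_1.  It is instead the set of values of
    all well-founded terms, and a term is coded by a function from finite paths
    to labels. *)
Lemma closing_off (T : Type) (t0 : T) (op : nat -> (nat -> T) -> T) :
  exists H : set T, [/\ H t0, H #<= continuum &
    forall k u, (forall i, H (u i)) -> H (op k u)].
Proof.
pose fix eval t := if t is node k f then op k (fun i => eval (f i)) else t0.
exists (range eval); split; first by exists leaf.
  exact: card_le_trans (card_image_le _ _) card_tree.
move=> k u Hu.
have /choice[f fu] i : exists t, eval t = u i.
  by have [t _ <-] := Hu i; exists t.
by exists (node k f) => //=; congr op; apply: funext.
Qed.

(** [compact_cover] speaks of pointed spaces; a nonempty [A] provides the
    point. *)
Lemma compact_finite_subcover (T : topologicalType) (A : set T)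
    (U : T -> set T) :
  compact A -> (forall x, A x -> open (U x) /\ U x x) ->
  exists s : seq T, (forall x, x \in s -> A x) /\
    forall y, A y -> exists2 x, x \in s & U x y.
Proof.
move=> Aco AU.
have [->|/set0P[x0 Ax0]] := eqVneq A set0; first by exists [::].
pose pT := HB.pack_for ptopologicalType T (isPointed.Build T x0).
have Aco' : @cover_compact pT A by rewrite -compact_cover.
have [||D DA AD] := Aco' T A U.
- by move=> x /AU[].
- by move=> x Ax; exists x => //; have [] := AU x Ax.
exists (finmap.enum_fset D); split=> [x /DA /set_mem//|y /AD[x xD Uxy]].
by exists x.
Qed.

(** Close a point under limits of sequences, and under the choice of a point
    outside each finite family of basic neighborhoods that does not cover [K].
    The resulting [H] has size at most the continuum, and it is closed, hence
    compact.  A point [q] outside [H] would give a cover of [H] by basic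
    neighborhoods missing [q]; a finite subcover misses [q], so [H] contains a
    point outside it, a contradiction. *)
Theorem card_compact_first_countable (K : topologicalType) :
  compact [set: K] -> first_countable K -> hausdorff_space K ->
  [set: K] #<= continuum.
Proof.
move=> Kco Kfc Kh.
have [->|/set0P[p0 _]] := eqVneq [set: K] set0; first exact: card_ge0.
have [b bP] := open_decreasing_base Kfc.
(* [op 0] picks a limit of [u]; [op k'.+1] decodes [k'] into radii for the
   first points of [u] and picks a point outside these basic neighborhoods *)
pose op k (u : nat -> K) : K :=
  if k is k'.+1 then
    if unpickle k' is Some s then
      xget p0 [set q | forall j, (j < size s)%N -> ~ b (u j) (nth 0%N s j) q]
    else p0
  else xget p0 [set l | forall V, nbhs l V -> \forall n \near \oo, V (u n)].
have [H [Hp0 Hc Hop]] := closing_off p0 op.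
have Hclosed : closed H.
  move=> p Hp.
  have /choice[u uP] (n : nat) : exists q, H q /\ b p n q.
    have [bo bp _ _] := bP p.
    by have [|q] := Hp (b p n); [exact: open_nbhs_nbhs|exists q].
  have pu : [set l | forall V, nbhs l V -> \forall n \near \oo, V (u n)] p.
    move=> V pV; have [_ _ bdec /(_ _ pV)[N NV]] := bP p.
    by exists N => // n Nn; apply/NV/(bdec _ _ Nn); have [] := uP n.
  have opu := xgetPex p0 (ex_intro _ p pu).
  suff -> : p = op 0%N u by apply: Hop => n; have [] := uP n.
  apply: Kh => A B /pu uA /opu uB.
  have [n [An Bn]] := filter_ex (filterI uA uB).
  by exists (u n).
apply: card_le_trans Hc; apply: subset_card_le => q _; apply: contrapT => nHq.
have Hco : compact H by exact: subclosed_compact Kco _.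
have /choice[m mP] (x : K) : exists n, H x -> ~ b x n q.
  have [Hx|nHx] := pselect (H x); last by exists 0%N.
  have xq : nbhs x (~` [set q]).
    apply: open_nbhs_nbhs; split; last by move=> xq; apply: nHq; rewrite -xq.
    rewrite openC; apply: accessible_closed_set1; exact: hausdorff_accessible.
  have [_ _ _ /(_ _ xq)[n nP]] := bP x.
  by exists n => _ /nP; apply.
have [|s [sH Hs]] := compact_finite_subcover (U := fun x => b x (m x)) Hco.
  by move=> x _; have [bo bx _ _] := bP x.
pose r := op (pickle (map m s)).+1 (nth p0 s).
have Hr : H r.
  apply: Hop => i; have [si|si] := ltnP i (size s).
    by apply: sH; exact: mem_nth.
  by rewrite nth_default.
have [x xs] := Hs r Hr.
have := @xgetPex K p0 [set q | forall j, (j < size (map m s))%N ->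
  ~ b (nth p0 s j) (nth 0%N (map m s) j) q].
rewrite /r /op pickleK => rP.
have : exists q, forall j, (j < size (map m s))%N ->
  ~ b (nth p0 s j) (nth 0%N (map m s) j) q.
  exists q => j; rewrite size_map => js; rewrite (nth_map p0) //.
  by apply: mP; apply: sH; exact: mem_nth.
move=> /rP/(_ (index x s)).
rewrite size_map index_mem (nth_map p0) ?index_mem // nth_index //.
by apply.
Qed.

(** * From the nabla product to the box product *)

Lemma accessible_box (X : nat -> topologicalType) :
  (forall n, accessible_space (X n)) -> accessible_space (box_product X).
Proof.
move=> XT1 x y xy.
have [n xyn] : exists n, x n <> y n.
  apply: contrapT => nxy; move/eqP: xy; apply.
  apply: functional_extensionality_dep => n.
  by apply: contrapT => xyn; apply: nxy; exists n.
exists (box (@dfwith _ (fun m => set (X m)) (fun=> setT) n (~` [set y n]))).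
split.
- apply: open_box => m; have [<-|nm] := eqVneq n m; last first.
    by rewrite dfwithout //; exact: openT.
  by rewrite dfwithin openC; exact: accessible_closed_set1.
- apply/mem_set => m; have [<-|nm] := eqVneq n m; last by rewrite dfwithout.
  by rewrite dfwithin.
- apply/mem_set => yU; have : ([set~ y n] : set (X n)) (y n).
    by have := yU n; rewrite dfwithin.
  by apply.
Qed.

Lemma seq_closed_discrete (T : topologicalType) (s : seq T) (x : T) :
  accessible_space T -> \forall y \near x, y \in s -> y = x.
Proof.
move=> /accessible_finite_set_closed Tfin.
have : nbhs x (~` ([set` s] `\ x)).
  apply: open_nbhs_nbhs; split; last by case=> _; apply.
  by rewrite openC; apply: Tfin; apply: finite_setD; exact: finite_seq.
by apply: filterS => y nsy ys; apply: contrapT => yx; apply: nsy.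
Qed.

Section CompactFactors.
Variable K : nat -> topologicalType.
Hypothesis Kco : forall n, compact [set: K n].
Implicit Types (x y z : box_product K) (w : nabla_product K).

(** The fibre of the quotient map through [x] is the increasing union of the sets
    [slab x n], and each of these is a copy of the finite product of the first
    [n] factors. *)
Definition slab x n : set (box_product K) :=
  [set y | forall m, (n <= m)%N -> y m = x m].

Lemma nabla_class_slab x y :
  nabla_class y = nabla_class x <-> exists n, slab x n y.
Proof.
rewrite nabla_classP; split=> [[n _ nP]|[n nP]]; exists n => // m; exact: nP.
Qed.

(** [slab x n.+1] is the continuous image of the product of [K n] with [slab x n]
    under the map that replaces the coordinate [n]. *)
Lemma slab_compact x n : compact (slab x n).
Proof.
elim: n => [|n IHn].
  suff -> : slab x 0 = [set x] by exact: compact_set1.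
  apply/seteqP; split=> [y yx|y ->] //.
  by apply: functional_extensionality_dep => m; exact: yx.
pose upd (p : K n * box_product K) : box_product K :=
  @dfwith _ (fun m => K m) p.2 n p.1.
have updc : continuous upd.
  move=> p W /nbhs_boxP[U [Uo Up UW]].
  exists (U n, box (@dfwith _ (fun m => set (K m)) U n setT)) => /=.
    split; apply: open_nbhs_nbhs; split => //.
    - by have := Up n; rewrite /upd dfwithin.
    - apply: open_box => m; have [<-|nm] := eqVneq n m.
        by rewrite dfwithin; exact: openT.
      by rewrite dfwithout.
    - move=> m; have [<-|nm] := eqVneq n m; first by rewrite dfwithin.
      by rewrite dfwithout //; have := Up m; rewrite /upd dfwithout.
  move=> q [q1 q2]; apply: UW => m; rewrite /upd.
  have [<-|nm] := eqVneq n m; first by rewrite dfwithin.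
  by rewrite dfwithout //; have := q2 m; rewrite dfwithout.
suff -> : slab x n.+1 = upd @` ([set: K n] `*` slab x n).
  apply: continuous_compact; first exact: continuous_subspaceT.
  exact: compact_setX.
apply/seteqP; split=> [y yx|_ [[a y] [_ yx] <-] m nm]; last first.
  by rewrite /upd dfwithout ?ltn_eqF //; apply: yx; exact: ltnW.
exists (y n, @dfwith _ (fun m => K m) y n (x n)).
  split=> // m; rewrite leq_eqVlt => /predU1P[<-|nm] /=.
    by rewrite dfwithin.
  by rewrite dfwithout ?ltn_eqF //; exact: yx.
apply: functional_extensionality_dep => m; rewrite /upd /=.
have [<-|nm] := eqVneq n m; first by rewrite dfwithin.
by rewrite !dfwithout.
Qed.

(** A tube lemma: intersect the finitely many boxes of a finite subcover in the
    coordinates from [n] on.  A point [y] meeting the bounds agrees below [n]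
    with a point [z] of the slab, and lies in the same box as [z]. *)
Lemma slab_tube x n (W : set (box_product K)) : open W -> slab x n `<=` W ->
  exists U : forall m, set (K m),
    [/\ forall m, open (U m), forall m, U m (x m) &
        forall y, (forall m, (n <= m)%N -> U m (y m)) -> W y].
Proof.
move=> Wo xW.
have H y : exists U : forall m, set (K m), W y ->
    [/\ forall m, open (U m), box U y & box U `<=` W].
  have [Wy|nWy] := pselect (W y); last by exists (fun=> setT).
  have /nbhs_boxP[U UP] : nbhs y W by exact: open_nbhs_nbhs.
  by exists U.
have /(_ _)/cid-/all_sig[U UP] := H.
have [|s [sx xs]] := compact_finite_subcover (U := fun y => box (U y))
    (@slab_compact x n).
  by move=> y /xW/UP[Uo Uy _]; split=> //; exact: open_box.
pose V m := [set a | forall i : 'I_(size s), (n <= m)%N -> U (nth x s i) m a].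
exists (fun m => (V m)°).
split=> [m|m|y yU].
- exact: open_interior.
- have : nbhs (x m) (V m); last by [].
  apply: filter_forall => i; have [nm|mn] := leqP n m; last first.
    by apply: filterS filterT.
  have ys : nth x s i \in s by exact: mem_nth.
  have [Uo Uy _] := UP _ (xW _ (sx _ ys)).
  have : nbhs (x m) (U (nth x s i) m).
    by apply: open_nbhs_nbhs; split => //; rewrite -(sx _ ys m nm); exact: Uy.
  by apply: filterS => a + _.
pose z : box_product K := fun m => if (n <= m)%N then x m else y m.
have zx : slab x n z by move=> m nm; rewrite /z nm.
have [e es ez] := xs _ zx.
have [_ _ eW] := UP e (xW _ (sx _ es)).
apply: eW => m; have [nm|mn] := leqP n m.
  have es' : (index e s < size s)%N by rewrite index_mem.
  have /interior_subset/(_ (Ordinal es') nm) := yU m nm.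
  by rewrite /= nth_index.
by have := ez m; rewrite /z leqNgt mn.
Qed.

(** The quotient map is closed.  The tubes around the slabs of [x] are combined
    diagonally: coordinate [m] satisfies the bounds of the tubes of index at
    most [m], so a sequence that is eventually within all bounds from [n] on lies
    in the tube of index [n]. *)
Lemma nabla_class_tube x (W : set (box_product K)) : open W ->
  nabla_class @^-1` [set nabla_class x] `<=` W ->
  \forall w \near nabla_class x, nabla_class @^-1` [set w] `<=` W.
Proof.
move=> Wo xW.
have H n : exists U : forall m, set (K m),
    [/\ forall m, open (U m), forall m, U m (x m) &
        forall y, (forall m, (n <= m)%N -> U m (y m)) -> W y].
  apply: slab_tube => // y yx; apply: xW; apply/nabla_class_slab.
  by exists n.
have /(_ _)/cid-/all_sig[U UP] := H.
pose V m := [set a | forall i : 'I_m.+1, U i m a]°.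
have : nbhs (nabla_class x) (eventually_in V).
  apply: open_nbhs_nbhs; split.
    by apply: open_eventually_in => m; exact: open_interior.
  apply/eventually_inE; exists 0%N => // m _.
  have : nbhs (x m) [set a | forall i : 'I_m.+1, U i m a]; last by [].
  apply: filter_forall => i; apply: open_nbhs_nbhs.
  by have [Uo Ux _] := UP i; split.
apply: filterS => w wV y yw; move: wV; rewrite -yw => /eventually_inE[n _ yV].
have [_ _ UW] := UP n; apply: UW => m nm.
have /interior_subset := yV m nm.
have nm1 : (n < m.+1)%N by [].
by move/(_ (Ordinal nm1)).
Qed.

Hypothesis KT1 : forall n, accessible_space (K n).

(** Go through the slabs in order, and cover the part of the next slab that is
    still uncovered by finitely many of its points.  A point chosen late is
    outside the neighborhoods of all points chosen before, so each of these
    neighborhoods contains only finitely many chosen points. *)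
Lemma fibre_closed_discrete_cover (N : box_product K -> set (box_product K))
    (x : box_product K) : neighbornet N ->
  exists E : set (box_product K),
    [/\ forall y, E y -> nabla_class y = nabla_class x,
        forall y, nabla_class y = nabla_class x ->
          \forall z \near y, E z -> z = y &
        forall y, nabla_class y = nabla_class x -> exists2 e, E e & N e y].
Proof.
move=> NN.
pose covered (l : seq (box_product K)) := \bigcup_(e in [set` l]) N e.
have next (l : seq (box_product K)) n : exists s : seq (box_product K),
    (forall y, y \in s -> slab x n y /\ ~ covered l y) /\
    forall y, slab x n y -> ~ covered l y -> exists2 e, e \in s & N e y.
  have lo : open (covered l) by apply: bigcup_open => e _; have [] := NN e.
  have Aco : compact (slab x n `&` ~` covered l).
    by apply: compact_closedI; [exact: slab_compact|rewrite closedC].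
  have [|s [sA As]] := compact_finite_subcover (U := N) Aco.
    by move=> y _; exact: NN.
  by exists s; split=> [y /sA[]|y xy ly] //; exact: As.
have /(_ _)/cid-/all_sig[s sP] := fun p => next p.1 p.2.
(* [l n] lists the points chosen for the first [n] slabs *)
pose l := fix l n := if n is m.+1 then s (l m, m) ++ l m else [::].
have lmono m n : (m <= n)%N -> {subset l m <= l n}.
  move=> /subnK <-; elim: (n - m)%N => [//|k IHk] y /IHk yl.
  by rewrite addSn /= mem_cat yl orbT.
have lx n y : y \in l n -> nabla_class y = nabla_class x.
  elim: n => //= n IHn; rewrite mem_cat => /orP[ys|//].
  by apply/nabla_class_slab; exists n; have [/(_ y ys)[]] := sP (l n, n).
have cover n y : slab x n y -> exists2 e, e \in l n.+1 & N e y.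
  move=> xy; have [[e el Ney]|ly] := pselect (covered (l n) y).
    by exists e => //=; rewrite mem_cat el orbT.
  have [_ /(_ y xy ly)[e es Ney]] := sP (l n, n).
  by exists e => //=; rewrite mem_cat es.
exists [set y | exists n, y \in l n]; split=> [y [n /lx]//|y|y]; last first.
  by move=> /nabla_class_slab[n /cover[e el Ney]]; exists e => //; exists n.+1.
move=> /nabla_class_slab[n /cover[e el Ney]].
have Ny : nbhs y (N e) by apply: open_nbhs_nbhs; split=> //; have [] := NN e.
have ly := seq_closed_discrete (l n.+1) y (accessible_box KT1).
apply: filterS2 Ny ly => z Nez lz [k zk]; apply: lz; apply: contrapT => zl.
(* a point chosen after stage n avoids N e *)
elim: k zk => //= k IHk; rewrite mem_cat => /orP[zs|//].
have [kn|nk] := leqP k n.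
  apply: zl; apply: (lmono k.+1) => //=; by rewrite mem_cat zs.
have [/(_ z zs)[_ +] _] := sP (l k, k); apply.
by exists e => //=; exact: lmono el.
Qed.

Lemma box_product_D_space :
  D_space (nabla_product K) -> D_space (box_product K).
Proof.
move=> nablaD N NN.
have /choice[E EP] (w : nabla_product K) :=
  fibre_closed_discrete_cover (repr w) NN.
(* [O w] consists of classes around [w] whose fibres are covered by the points
   chosen in the fibre of [w] *)
pose O w := [set v | nabla_class @^-1` [set v] `<=` \bigcup_(e in E w) N e]°.
have ON : neighbornet O.
  move=> w; split; first exact: open_interior.
  have := @nabla_class_tube (repr w) (\bigcup_(e in E w) N e).
  rewrite nabla_class_repr; apply.
    by apply: bigcup_open => e _; have [] := NN e.
  move=> y yw; have [_ _ /(_ y)] := EP w; rewrite nabla_class_repr.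
  by move=> /(_ yw)[e Ee Ney]; exists e.
have [D [Dcl Ddisc Dcov]] := nablaD O ON.
have Dtriv := (closed_discreteP D).2 (conj Dcl Ddisc).
exists (\bigcup_(w in D) E w).
have /closed_discreteP[? ?] : forall y, \forall z \near y,
    (\bigcup_(w in D) E w) z -> z = y.
  move=> y.
  have yD : \forall z \near y,
      D (nabla_class z) -> nabla_class z = nabla_class y.
    exact: (@pi_continuous _ _ y _ (Dtriv (nabla_class y))).
  have yE : \forall z \near y, E (nabla_class y) z -> z = y.
    by have [_ + _] := EP (nabla_class y); apply; rewrite nabla_class_repr.
  apply: filterS2 yD yE => z zD zE [w Dw Ewz]; apply: zE.
  have [/(_ _ Ewz) + _ _] := EP w; rewrite nabla_class_repr => zw.
  by move: zD; rewrite zw => /(_ Dw) <-.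
split=> //; apply/seteqP; split=> // y _.
have [w Dw wy] : (\bigcup_(w in D) O w) (nabla_class y) by rewrite Dcov.
have [e Ee Ney] := interior_subset wy y erefl.
by exists e => //; exists w.
Qed.

End CompactFactors.

Theorem proposition24 :
  (forall X : nat -> topologicalType,
     (forall n, first_countable (X n)) ->
     (forall n, hausdorff_space (X n)) ->
     (forall A : set (nabla_product X),
        A #<= dominating_number -> hereditarily_D (set_type A)) /\
     (dominating_number #= continuum ->
        (forall n, [set: X n] #<= continuum) ->
        hereditarily_D (nabla_product X))) /\
  (dominating_number #= continuum ->
     forall K : nat -> topologicalType,
       (forall n, compact [set: K n]) ->
       (forall n, first_countable (K n)) ->
       (forall n, hausdorff_space (K n)) ->
       D_space (box_product K)).
Proof.
have nabla_small X : (forall n, first_countable (X n)) ->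
    (forall n, hausdorff_space (X n)) ->
    small_closed_discrete dominating_number (nabla_product X).
  move=> Xfc Xh; apply: nabla_small_closed_discrete => // n.
  exact: hausdorff_accessible.
have card_nabla (X : nat -> topologicalType) :
    dominating_number #= continuum -> (forall n, [set: X n] #<= continuum) ->
    [set: nabla_product X] #<= dominating_number.
  move=> dc /card_prod_continuum Xc; rewrite (card_le_eqr dc).
  apply: card_le_trans Xc.
  apply: (card_le_of_injection (f := repr)) => // v w _ _.
  exact: (can_inj (@nabla_class_repr X)).
split=> [X Xfc Xh|dc K Kco Kfc Kh].
  have Xsmall := nabla_small X Xfc Xh; split=> [A Ad|dc Xc].
    apply: small_closed_discrete_hereditarily_D dominating_number_infinite _ _.
      exact: small_closed_discrete_sub.
    by rewrite (card_le_eql (card_setT A)).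
  apply: small_closed_discrete_hereditarily_D dominating_number_infinite _ _.
    exact: Xsmall.
  exact: card_nabla.
apply: box_product_D_space => // [n|]; first exact: hausdorff_accessible.
apply: small_closed_discrete_D_space dominating_number_infinite _ _.
  exact: nabla_small.
by apply: card_nabla => // n; exact: card_compact_first_countable.
Qed.
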